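(* Let $n\ge 2$ and $c\ge 2$. Let $f:\mathbb{H}^n\to\mathbb{H}^n=f(\mathbb{H}^n)$ be a Möbius transformation. Then, for all $x,y\in\mathbb{H}^n$, $$h_{\mathbb{H}^n,c}(f(x),f(y))=h_{\mathbb{H}^n,c}(x,y).$$
   Context: $\mathbb{R}^n$ carries the Euclidean norm $|\cdot|$; $\mathbb{H}^n=\{x=(x_1,\dots,x_n)\in\mathbb{R}^n:x_n>0\}$ is the upper half space. For a nonempty open set $D\subset\mathbb{R}^n$ with nonempty boundary $\partial D$ (taken in $\mathbb{R}^n$), let $d_D(x)=\inf_{z\in\partial D}|x-z|$ and, for $x,y\in D$, $$h_{D,c}(x,y)=\log\left(1+c\,\frac{|x-y|}{\sqrt{d_D(x)\,d_D(y)}}\right).$$ In particular $d_{\mathbb{H}^n}(x)=x_n$ for $x\in\mathbb{H}^n$. For $c\ge 2$, $h_{D,c}$ is a metric on $D$. A Möbius transformation of a domain onto another is the restriction to the domain of a Möbius transformation of $\overline{\mathbb{R}^n}=\mathbb{R}^n\cup\{\infty\}$ (a finite composition of reflections in hyperplanes and inversions in spheres; orientation-reversing maps are allowed). *)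

(* Defs.v *)
From mathcomp Require Import all_boot all_order all_algebra.
From mathcomp Require Import all_classical all_reals all_analysis.

Set Implicit Arguments.
Unset Strict Implicit.
Unset Printing Implicit Defensive.

Import Order.TTheory GRing.Theory Num.Theory.
Import numFieldNormedType.Exports.

Local Open Scope classical_set_scope.
Local Open Scope ring_scope.

Section Euclidean.
Context {R : realType} {n : nat}.
Implicit Types (x y : 'rV[R]_n) (D : set 'rV[R]_n).

Definition dot x y : R := \sum_(i < n) x ord0 i * y ord0 i.

(* The library's norm on row vectors is the sup norm; it induces the same
   topology as [enorm], so [closure] and [interior] below are the usual ones. *)
Definition enorm x : R := Num.sqrt (dot x x).

Definition boundary D : set 'rV[R]_n := closure D `\` interior D.

Definition bdist D x : R := inf [set enorm (x - z) | z in boundary D].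

Definition hmetric D (c : R) x y : R :=
  ln (1 + c * (enorm (x - y) / Num.sqrt (bdist D x * bdist D y))).

End Euclidean.

(* The one-point extension of R^n, with [None] as the point at infinity. *)
Definition extended (R : realType) (n : nat) := option 'rV[R]_n.

Section Moebius.
Context {R : realType} {n : nat}.

(* Reflection in the hyperplane {v | dot v a = t}, for a != 0. *)
Definition reflection (a : 'rV[R]_n) (t : R) (x : extended R n) :
    extended R n :=
  if x is Some v then Some (v - (2 * (dot v a - t) / dot a a) *: a) else None.

(* Inversion in the sphere {v | enorm (v - a) = r}, for 0 < r. *)
Definition inversion (a : 'rV[R]_n) (r : R) (x : extended R n) :
    extended R n :=
  if x is Some v then
    if v == a then None
    else Some (a + (r ^+ 2 / enorm (v - a) ^+ 2) *: (v - a))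
  else Some a.

Inductive moebius : (extended R n -> extended R n) -> Prop :=
| moebius_id : moebius id
| moebius_reflection a t g :
    a != 0 -> moebius g -> moebius (reflection a t \o g)
| moebius_inversion a r g :
    0 < r -> moebius g -> moebius (inversion a r \o g).

(* Only the values of [f] on [D] matter. *)
Definition moebius_onto (D D' : set 'rV[R]_n) (f : 'rV[R]_n -> 'rV[R]_n) :=
  (exists2 g, moebius g & forall x, D x -> g (Some x) = Some (f x)) /\
  f @` D = D'.

End Moebius.

Definition halfspace (R : realType) (n : nat) : set 'rV[R]_n.+1 :=
  [set x | 0 < x ord0 ord_max].

Arguments halfspace : clear implicits.

(* Main.v *)
(** A Moebius transformation [g] multiplies the squared chordal kernel
    [|x - y|^2], homogenised at infinity, by [l x * l y] for some positive [l],
    and pulls a quadric [A |x|^2 + b.x + C] back to [l] times a quadric of the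
    same discriminant [b.b - 4 A C]; both facts need only be checked on
    reflections and inversions.  If [g] preserves the half space, the pull-back
    of the last coordinate is positive exactly on the half space, which forces
    it to be [l x * x_n].  Hence [|x - y|^2 / (x_n y_n)] is invariant. *)
Require Import Defs.
From mathcomp Require Import all_boot all_order all_algebra.
From mathcomp Require Import all_classical all_reals all_analysis.
From mathcomp Require Import ring lra.

Import Order.TTheory GRing.Theory Num.Theory.
Import numFieldNormedType.Exports.

Local Open Scope classical_set_scope.
Local Open Scope ring_scope.

(** * Bilinearity and positivity of the Euclidean inner product *)

Section Dot.
Context {R : realType} {n : nat}.
Implicit Types (x y z : 'rV[R]_n) (k : R).

Lemma dotC x y : dot x y = dot y x.
Proof. by apply: eq_bigr => i _; rewrite mulrC. Qed.

Lemma dotDl x y z : dot (x + y) z = dot x z + dot y z.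
Proof. by rewrite -big_split; apply: eq_bigr => i _; rewrite mxE mulrDl. Qed.

Lemma dotZl k x y : dot (k *: x) y = k * dot x y.
Proof. by rewrite /dot mulr_sumr; apply: eq_bigr => i _; rewrite mxE mulrA. Qed.

Lemma dotNl x y : dot (- x) y = - dot x y.
Proof. by rewrite -scaleN1r dotZl mulN1r. Qed.

Lemma dotDr x y z : dot z (x + y) = dot z x + dot z y.
Proof. by rewrite dotC dotDl !(dotC z). Qed.

Lemma dotZr k x y : dot x (k *: y) = k * dot x y.
Proof. by rewrite dotC dotZl dotC. Qed.

Lemma dotNr x y : dot x (- y) = - dot x y.
Proof. by rewrite dotC dotNl dotC. Qed.

Lemma dot_ge0 x : 0 <= dot x x.
Proof. by apply: sumr_ge0 => i _; rewrite -expr2 sqr_ge0. Qed.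

Lemma dot_eq0 x : (dot x x == 0) = (x == 0).
Proof.
apply/eqP/eqP => [x0|->]; last by rewrite /dot big1 // => i _; rewrite mxE mul0r.
apply/rowP => i; rewrite mxE; apply/eqP; rewrite -sqrf_eq0 expr2; apply/eqP.
by apply: (psumr_eq0P _ x0) => // j _; rewrite -expr2 sqr_ge0.
Qed.

Lemma dot_gt0 x : (0 < dot x x) = (x != 0).
Proof. by rewrite lt_def dot_eq0 dot_ge0 andbT. Qed.

Lemma dot_delta x i : dot x (delta_mx ord0 i) = x ord0 i.
Proof.
rewrite /dot (bigD1 i) //= big1 ?addr0 ?mxE ?eqxx ?mulr1 // => j ji.
by rewrite mxE (negPf ji) mulr0.
Qed.

Lemma enorm_sqr x : enorm x ^+ 2 = dot x x.
Proof. by rewrite sqr_sqrtr // dot_ge0. Qed.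

Lemma coord_le_enorm x i : `|x ord0 i| <= enorm x.
Proof.
rewrite -sqrtr_sqr ler_wsqrtr // /dot (bigD1 i) //= expr2 lerDl.
by apply: sumr_ge0 => j _; rewrite -expr2 sqr_ge0.
Qed.

End Dot.

Definition dotE {R : realType} {n : nat} :=
  (@dotDl R n, @dotDr R n, @dotZl R n, @dotZr R n, @dotNl R n, @dotNr R n).

(** * Conformal factors of Moebius transformations of the extended space *)

Section Conformal.
Context {R : realType} {n : nat}.
Implicit Types (p q : Defs.extended R n)
  (g : Defs.extended R n -> Defs.extended R n).

(** The values at infinity are limits after division by [|x|^2] for each argument that tends to
    infinity. Up to a constant, this is the Lorentz product of the null vectors [(|x|^2, x, 1)],
    with infinity as [(1, 0, 0)]. *)
Definition kernel p q : R :=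
  match p, q with
  | Some x, Some y => dot (x - y) (x - y)
  | None, None => 0
  | _, _ => 1
  end.

(* The function [A |x|^2 + b.x + C]; at infinity, its leading coefficient. *)
Definition quadric (A : R) (b : 'rV[R]_n) (C : R) p : R :=
  if p is Some x then A * dot x x + dot b x + C else A.

(** On null vectors [g] acts as a Lorentz map up to the factor [l]. Quadrics are the linear forms on
    these vectors, and the discriminant is the dual Lorentz form. *)
Definition conformal g (l : Defs.extended R n -> R) :=
  [/\ forall p, 0 < l p,
      forall p q, kernel (g p) (g q) = l p * l q * kernel p q &
      forall A b C, exists A' b' C',
        dot b' b' - 4 * A' * C' = dot b b - 4 * A * C /\
        forall p, quadric A b C (g p) = l p * quadric A' b' C' p].

Lemma kernel_eq0 p q : kernel p q = 0 -> p = q.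
Proof.
case: p q => [x|] [y|] //=; try by move/eqP; rewrite oner_eq0.
by move/eqP; rewrite dot_eq0 subr_eq0 => /eqP ->.
Qed.

Lemma kernelxx p : kernel p p = 0.
Proof. by case: p => [x|] //=; apply/eqP; rewrite dot_eq0 subrr. Qed.

(** The kernel vanishes only on the diagonal, and positive factors preserve its zeros. *)
Lemma conformal_inj g l : conformal g l -> injective g.
Proof.
case=> l0 lK _ p q gpq; apply: kernel_eq0; apply/eqP.
have /eqP := lK p q; rewrite gpq kernelxx eq_sym !mulf_eq0.
by rewrite (gt_eqF (l0 p)) (gt_eqF (l0 q)).
Qed.

Lemma conformal_comp g h l m :
  conformal g l -> conformal h m -> conformal (g \o h) (fun p => l (h p) * m p).
Proof.
move=> [l0 lK lQ] [m0 mK mQ]; split=> [p|p q|A b C].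
- exact: mulr_gt0.
- by rewrite /= lK mK; ring.
- have [A1 [b1 [C1 [d1 e1]]]] := lQ A b C.
  have [A2 [b2 [C2 [d2 e2]]]] := mQ A1 b1 C1.
  exists A2, b2, C2; split=> [|p]; first by rewrite d2.
  by rewrite /= e1 e2 mulrA.
Qed.

Lemma conformal_id : conformal id (fun=> 1).
Proof.
split=> [p|p q|A b C]; rewrite ?mul1r //.
by exists A, b, C; split=> // p; rewrite mul1r.
Qed.

Lemma conformal_reflection (a : 'rV[R]_n) t :
  a != 0 -> conformal (reflection a t) (fun=> 1).
Proof.
rewrite -dot_eq0 => a0; split=> [//|[x|] [y|]|A b C]; rewrite ?mul1r //=.
  rewrite !dotE !(dotC y) !(dotC a x) !(dotC a y).
  by field.
(* The image [x'] of [x] satisfies [|x'|^2 = |x|^2 - 4 t (a.x - t) / a.a], so no new quadratic term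
   appears. *)
exists A, (b - ((4 * t * A + 2 * dot a b) / dot a a) *: a),
  (C + 4 * t ^+ 2 * A / dot a a + 2 * t * dot a b / dot a a).
split=> [|[x|]]; rewrite ?mul1r //= !dotE ?(dotC b a) ?(dotC x a) //; by field.
Qed.

(** The values at [a] and at infinity, which the inversion exchanges, are forced by the kernel law:
    their product must be 1. *)
Definition inversion_factor (a : 'rV[R]_n) (r : R) p : R :=
  if p is Some v then
    if v == a then r ^- 2 else r ^+ 2 / dot (v - a) (v - a)
  else r ^+ 2.

Lemma conformal_inversion (a : 'rV[R]_n) r :
  0 < r -> conformal (inversion a r) (inversion_factor a r).
Proof.
move=> r0; have rn0 : r != 0 by rewrite gt_eqF.
have sub_dot_neq0 x : x != a -> dot (x - a) (x - a) != 0.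
  by rewrite dot_eq0 subr_eq0.
split=> [[x|]|[x|] [y|]|A b C] /=.
- case: eqVneq => [_|xa]; first by rewrite invr_gt0 exprn_gt0.
  by rewrite divr_gt0 ?exprn_gt0 // dot_gt0 subr_eq0.
- by rewrite exprn_gt0.
- case: (eqVneq x a) => [->|xa]; case: (eqVneq y a) => [->|ya].
  + by rewrite subrr -(scale0r 0) dotZl !mul0r mulr0.
  + rewrite /= -[a - y]opprB dotNl dotNr opprK mulrA.
    by field; rewrite sub_dot_neq0.
  + by rewrite /=; field; rewrite rn0 sub_dot_neq0.
  + rewrite /= !enorm_sqr.
    have := sub_dot_neq0 _ ya; have := sub_dot_neq0 _ xa.
    (* With the centre moved to the origin, the claim is [|u/|u|^2 - v/|v|^2|^2 = |u - v|^2 / (|u|^2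
       |v|^2)], scaled by [r^4]. *)
    have -> : x - y = (x - a) - (y - a) by rewrite opprB addrA subrK.
    move: (x - a) (y - a) => u v u0 v0.
    rewrite opprD addrACA subrr add0r !dotE !(dotC v u).
    by field; rewrite u0 v0.
- case: (eqVneq x a) => [_|xa] /=; first by field.
  have := sub_dot_neq0 _ xa; rewrite enorm_sqr addrAC subrr add0r.
  by move: (x - a) => w w0; rewrite !dotE; field.
- case: (eqVneq y a) => [_|ya] /=; first by field.
  have := sub_dot_neq0 _ ya; rewrite enorm_sqr opprD addrA subrr add0r.
  by move: (y - a) => w w0; rewrite !dotE; field.
- by rewrite mulr0 subrr -(scale0r 0) dotZl mul0r.
(* Infinity goes to [a] with factor [r^2], so [m] must be the leading coefficient. In [w = x - a]
   the pull-back is [m |w|^2 + (2 A a + b).w + A r^2]; the witnesses expand it in [x]. *)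
pose m := quadric A b C (Some a) / r ^+ 2.
exists m, ((2 * A - 2 * m) *: a + b),
  (m * dot a a - 2 * A * dot a a - dot a b + A * r ^+ 2).
rewrite /m /=; split=> [|[x|]] /=.
- by rewrite !dotE (dotC b a); field.
- case: (eqVneq x a) => [->|xa] /=.
    by rewrite !dotE (dotC b a); field.
  have := sub_dot_neq0 _ xa; have -> : x = a + (x - a) by rewrite addrC subrK.
  move: (x - a) => w; rewrite addrAC subrr add0r enorm_sqr => w0.
  by rewrite !dotE !(dotC b a) !(dotC w a); field; rewrite rn0.
- by field.
Qed.

Lemma moebius_conformal g : moebius g -> exists l, conformal g l.
Proof.
elim=> [|a t h a0 _ [l hl]|a r h r0 _ [l hl]].
- by exists (fun=> 1); exact: conformal_id.
- by eexists; apply: conformal_comp hl; exact: conformal_reflection.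
- by eexists; apply: conformal_comp hl; exact: conformal_inversion.
Qed.

End Conformal.

(** * Boundary distance and defining quadrics of the half space *)

Section Halfspace.
Context {R : realType} {n : nat}.
Implicit Types x y z : 'rV[R]_n.+1.

Let e : 'rV[R]_n.+1 := delta_mx ord0 ord_max.

Lemma boundary_halfspace :
  boundary (halfspace R n) = [set x | x ord0 ord_max = 0].
Proof.
have op : open (halfspace R n).
  apply: (@open_comp _ _ (fun x : 'rV[R]_n.+1 => x ord0 ord_max)
    [set t | 0 < t]).
    by move=> x _; exact: coord_continuous.
  exact: open_gt.
rewrite /boundary (interior_id _).1 //; apply/seteqP; split=> x.
  case=> cx /negP; rewrite -leNgt => x0.
  apply/eqP; rewrite eq_le x0 /=.
  have cl : closed [set x : 'rV[R]_n.+1 | 0 <= x ord0 ord_max].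
    apply: (@closed_comp _ _ (fun x : 'rV[R]_n.+1 => x ord0 ord_max)
      [set t | 0 <= t]).
      by move=> z _; exact: coord_continuous.
    exact: closed_ge.
  have /(_ x cx) := @closure_subset _ (halfspace R n) _ (fun z => @ltW _ _ _ _).
  by rewrite -((closure_id _).1 cl).
move=> /= x0; split; last by rewrite /halfspace /= x0 ltxx.
move=> B /nbhs_ballP[d /= d0 dB]; exists (x + (d / 2) *: e); split.
  by rewrite /halfspace /= !mxE x0 !eqxx mulr1 add0r divr_gt0.
apply: dB; split=> // i j; rewrite /ball /= !mxE opprD addNKr normrN normrM.
rewrite gtr0_norm ?divr_gt0 //.
by case: (_ && _); rewrite ?normr1 ?normr0; lra.
Qed.

(** The infimum is attained at the foot of the perpendicular, since a coordinate of a difference is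
    at most its norm. *)
Lemma bdist_halfspace x :
  halfspace R n x -> bdist (halfspace R n) x = x ord0 ord_max.
Proof.
rewrite /halfspace /= => x0; rewrite /bdist boundary_halfspace.
set S := (X in inf X).
have Sx : S (x ord0 ord_max).
  exists (x - x ord0 ord_max *: e); first by rewrite /= !mxE !eqxx mulr1 subrr.
  rewrite opprB addrC subrK /enorm dotZl dotZr dot_delta mxE !eqxx mulr1.
  by rewrite -expr2 sqrtr_sqr gtr0_norm.
have lbS : lbound S (x ord0 ord_max).
  move=> _ [z /= z0 <-]; apply: le_trans (coord_le_enorm _ ord_max).
  by rewrite !mxE z0 subr0 ler_norm.
apply/eqP; rewrite eq_le lb_le_inf ?andbT; [|by exists (x ord0 ord_max)|by []].
by apply: ge_inf => //; exists (x ord0 ord_max).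
Qed.

(* Such a quadric vanishes on the boundary hyperplane, where its restriction
   has only zero coefficients; the discriminant then fixes the remaining one. *)
Lemma quadric_halfspace (A : R) (b : 'rV[R]_n.+1) (C : R) :
  (0 < n)%N -> dot b b - 4 * A * C = 1 ->
  (forall x, halfspace R n x <-> 0 < quadric A b C (Some x)) ->
  forall x, quadric A b C (Some x) = x ord0 ord_max.
Proof.
move=> n0 disc hq.
have q0 x : x ord0 ord_max = 0 -> quadric A b C (Some x) = 0.
  move=> x0; apply/eqP; rewrite eq_le; apply/andP; split.
    by rewrite leNgt; apply/negP => /hq; rewrite /halfspace /= x0 ltxx.
  rewrite leNgt; apply/negP => qx.
  (* Moving up from [x] by [t] enters the half space; a negative value at [x] would persist for
     small [t]. *)
  have qt t : 0 < t ->
      0 < quadric A b C (Some x) + t * (b ord0 ord_max + A * t).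
    move=> t0; have /hq : halfspace R n (x + t *: e).
      by rewrite /halfspace /= !mxE !eqxx x0 mulr1 add0r.
    rewrite /= !dotE (dotC e x) !dot_delta x0 mxE !eqxx.
    by rewrite mulr1; congr (_ < _); ring.
  move: (quadric A b C (Some x)) qx qt => q qx qt.
  (* For [t = -q / (M - q)], which lies in [(0, 1)], the value is at most
     [q + t (M - 1) = t q - t < 0]. *)
  pose M := 1 + `|b ord0 ord_max| + `|A|.
  have A0 := normr_ge0 A; have b0 := normr_ge0 (b ord0 ord_max).
  have Mq : 0 < M - q by rewrite /M; lra.
  have t0 : 0 < - q / (M - q) by rewrite divr_gt0 ?oppr_gt0.
  have tM : - q / (M - q) * (M - q) = - q by rewrite divfK ?gt_eqF.
  have t1 : - q / (M - q) < 1 by rewrite ltr_pdivrMr // /M; lra.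
  have := qt _ t0; move: (- q / (M - q)) t0 t1 tM => t t0 t1 tM; apply/negP.
  have At : A * t <= `|A|.
    by rewrite (le_trans (ler_norm _)) // normrM (gtr0_norm t0) ler_piMr // ltW.
  have bt : t * (b ord0 ord_max + A * t) <= t * (M - 1).
    by rewrite ler_pM2l // /M; have := ler_norm (b ord0 ord_max); lra.
  have tq : t * q < 0 by rewrite pmulr_rlt0.
  by rewrite -leNgt; lra.
have C0 : C = 0.
  have := q0 0; rewrite /= -(scale0r 0) !dotE !mul0r mulr0 !add0r.
  by apply; rewrite scale0r mxE.
have coef0 i : i != ord_max -> A = 0 /\ b ord0 i = 0.
  move=> im; pose d : 'rV[R]_n.+1 := delta_mx ord0 i.
  have qd t : A * (t * t) + t * b ord0 i = 0.
    have := q0 (t *: d); rewrite /= !dotE !dot_delta C0 !mxE !eqxx.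
    rewrite eq_sym (negPf im) !mulr0 !mulr1 addr0; exact.
  (* The values at [1] and [-1] separate the even coefficient [A] from the odd one. *)
  by have := qd 1; have := qd (-1); lra.
have [A0 _] : A = 0 /\ b ord0 ord0 = 0.
  by apply: coef0; rewrite -val_eqE /= eq_sym -lt0n.
have bE : b = b ord0 ord_max *: delta_mx ord0 ord_max.
  apply/rowP => i; rewrite !mxE eqxx /=; case: eqVneq => [->|/coef0[_ ->]].
    by rewrite mulr1.
  by rewrite mulr0.
(* The discriminant gives the square of this coefficient; positivity at the unit normal gives its
   sign. *)
have b1 : b ord0 ord_max = 1.
  have b_gt0 : 0 < b ord0 ord_max.
    have /hq : halfspace R n (delta_mx ord0 ord_max).
      by rewrite /halfspace /= mxE !eqxx.
    by rewrite /= A0 C0 mul0r add0r addr0 dot_delta.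
  have := disc; rewrite A0 [X in dot X _]bE dotZl dotC dot_delta.
  rewrite mulr0 mul0r subr0 => bb.
  by apply/eqP; rewrite -(@pexpr_eq1 _ _ 2) ?(ltW b_gt0) // expr2 bb.
by move=> x; rewrite /= A0 C0 mul0r add0r addr0 bE b1 scale1r dotC dot_delta.
Qed.

End Halfspace.

Theorem theorem1p3 (R : realType) (n : nat) (c : R)
    (f : 'rV[R]_n.+1 -> 'rV[R]_n.+1) :
  (2 <= n.+1)%N -> 2 <= c ->
  moebius_onto (halfspace R n) (halfspace R n) f ->
  forall x y : 'rV[R]_n.+1, halfspace R n x -> halfspace R n y ->
    hmetric (halfspace R n) c (f x) (f y) = hmetric (halfspace R n) c x y.
Proof.
move=> n0 _ [[g mg gf] fH] x y xH yH.
have [l cl] := moebius_conformal _ mg; have [l0 lK lQ] := cl.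
have fS z : halfspace R n z -> halfspace R n (f z).
  by move=> zH; rewrite -fH; exists z.
pose e : 'rV[R]_n.+1 := delta_mx ord0 ord_max.
have coordE (p : Defs.extended R n.+1) : quadric 0 e 0 p =
    if p is Some z then z ord0 ord_max else 0.
  by case: p => [z|] //=; rewrite mul0r add0r addr0 dotC dot_delta.
have [A [b [C [disc qE]]]] := lQ 0 e 0.
(* Conversely, positivity makes [g (Some z)] a finite point of the half space, because the last
   coordinate counts as 0 at infinity. That point is [f z'] for some [z'] in the half space, and
   injectivity of [g] gives [z' = z]. *)
have qH z : halfspace R n z <-> 0 < quadric A b C (Some z).
  rewrite -(pmulr_rgt0 _ (l0 (Some z))) -qE coordE; split=> [zH|].
    by rewrite gf //; exact: fS.
  case gz : (g (Some z)) => [w|]; last by rewrite ltxx.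
  move=> wH; have [z' z'H fz'] : (f @` halfspace R n) w by rewrite fH.
  have /(conformal_inj _ _ cl)[<-] // : g (Some z') = g (Some z).
  by rewrite gf // fz' gz.
have disc1 : dot b b - 4 * A * C = 1.
  by rewrite disc dot_delta mxE !eqxx mulr0 subr0.
have fE z : halfspace R n z -> (f z) ord0 ord_max = l (Some z) * z ord0 ord_max.
  move=> zH; have := qE (Some z); rewrite gf // coordE => ->.
  by rewrite (quadric_halfspace _ _ _ n0 disc1 qH).
rewrite /hmetric !bdist_halfspace //; [|exact: fS..].
congr (ln (1 + c * _)).
have fK : dot (f x - f y) (f x - f y) =
    l (Some x) * l (Some y) * dot (x - y) (x - y).
  by have := lK (Some x) (Some y); rewrite !gf.
have ll : 0 < l (Some x) * l (Some y) by exact: mulr_gt0.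
(* The factor [k] occurs under both square roots of the quotient and cancels. *)
rewrite !fE // mulrACA /enorm fK; move: (l (Some x) * l (Some y)) ll => k k0.
rewrite !(sqrtrM _ (ltW k0)) -mulf_div divff ?mul1r //.
by rewrite gt_eqF // sqrtr_gt0.
Qed.
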